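(* Let $d\ge 3$ be an odd integer and $k\ge 1$. For $h_1,h_2,\dots,h_{d^k}\in G_d$, we have $(h_1,h_2,\dots,h_{d^k})\in \psi_k(\mathrm{St}_{G_d}(\widehat{k}))$ if and only if for all $1\le r\le k$ and $0\le t<d^{k-r}$, $$\sum_{i=1}^{d^r}|h_{d^rt+i}|_A\equiv 0 \pmod{2^{r+1}}.$$
   Context: Let $d\ge 3$ be odd and $X=\{1,\dots,d\}$. Let $T$ be the $d$-regular rooted tree whose vertex set is the set $X^*$ of finite words over $X$, with root the empty word, the children of $u$ being $ux$, $x\in X$; $X^k$ is the $k$-th level. $\mathrm{Aut}(T)$ is the group of root-preserving graph automorphisms of $T$, with product $gh(u)=h(g(u))$ and identity $e$. For $g\in\mathrm{Aut}(T)$ and $u\in X^*$, the section $g|_u\in\mathrm{Aut}(T)$ is determined by $g(uv)=g(u)\,g|_u(v)$ for all $v\in X^*$. The wreath recursion of $g$ is $g=(g|_1,\dots,g|_d)\lambda_g$, where $\lambda_g\in S_d$ is the permutation induced by $g$ on $X$; it determines $g$. The group $G_d\le \mathrm{Aut}(T)$ is generated by $A=\{a_1,\dots,a_d\}$, defined recursively by: for $1\le i\le d-1$, $\lambda_{a_i}=(i\ \,i+1)$, $a_i|_i=a_i$, $a_i|_{i+1}=a_{i+1}$, and $a_i|_x=e$ for all other $x\in X$; and $\lambda_{a_d}=(d\ 1)$, $a_d|_1=a_1$, $a_d|_d=a_d$, and $a_d|_x=e$ for all other $x\in X$. The group $G_d$ is self-similar (all sections of its elements lie in $G_d$). $|g|_A\in\mathbb{Z}$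 denotes the sum of all exponents of a word over $A\cup A^{-1}$ representing $g\in G_d$; it is known (for $d$ odd) that any word representing the identity has exponent sum $0$ in each generator, so $|g|_A$ is well defined. $\mathrm{St}_{G_d}(\widehat{k})$ is the subgroup of elements of $G_d$ fixing every vertex of $X^k$, and $\psi_k:\mathrm{St}_{G_d}(\widehat{k})\to G_d^{\,d^k}$ is the injective homomorphism $g\mapsto (g|_u)_{u\in X^k}$, with $X^k$ ordered lexicographically (the paper identifies $g$ with $\psi_k(g)$). *)

(* Defs.v *)
From HB Require Import structures.
From mathcomp Require Import all_boot all_order all_algebra.
From mathcomp Require Import boolp classical_sets.

Set Implicit Arguments.
Unset Strict Implicit.
Unset Printing Implicit Defensive.

Import Order.TTheory GRing.Theory.
Local Open Scope classical_set_scope.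

(* The letters 1, ..., d of X are the elements 0, ..., d - 1 of 'I_d. *)
Definition adj d (u v : seq 'I_d) : bool :=
  [exists x, v == rcons u x] || [exists x, u == rcons v x].

Record tree_aut d := TreeAut {
  aut_fun :> seq 'I_d -> seq 'I_d;
  aut_inv : seq 'I_d -> seq 'I_d;
  aut_funK : cancel aut_fun aut_inv;
  aut_invK : cancel aut_inv aut_fun;
  aut_adj : forall u v, adj (aut_fun u) (aut_fun v) = adj u v;
  aut_root : aut_fun [::] = [::]
}.

HB.instance Definition _ d := gen_eqMixin (tree_aut d).
HB.instance Definition _ d := gen_choiceMixin (tree_aut d).

Lemma tree_autP d (g h : tree_aut d) : g =1 h -> g = h.
Proof.
case: g h => [f f' fK f'K fa fr] [k k' kK k'K ka kr] /= fk.
have {}fk : f = k by apply/funext.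
subst k; have fk' : f' = k'.
  by apply/funext => u; rewrite -{1}(k'K u) fK.
by subst k'; congr TreeAut; exact: Prop_irrelevance.
Qed.

Section AutGroup.
Variable d : nat.
Implicit Types (g h : tree_aut d) (u v : seq 'I_d).

Definition aut_one : tree_aut d :=
  @TreeAut d id id (fun _ => erefl) (fun _ => erefl)
    (fun _ _ => erefl) erefl.

Lemma aut_inv_adj g u v : adj (aut_inv g u) (aut_inv g v) = adj u v.
Proof. by rewrite -(aut_adj g) !aut_invK. Qed.

Lemma aut_inv_root g : aut_inv g [::] = [::].
Proof. by rewrite -{1}(aut_root g) aut_funK. Qed.

Definition aut_invg g : tree_aut d :=
  TreeAut (@aut_invK d g) (@aut_funK d g) (aut_inv_adj g) (aut_inv_root g).

Lemma aut_mul_adj g h u v : adj (h (g u)) (h (g v)) = adj u v.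
Proof. by rewrite !aut_adj. Qed.

Lemma aut_mul_root g h : h (g [::]) = [::].
Proof. by rewrite !aut_root. Qed.

(* Automorphisms act on the right: g * h applies g first. *)
Definition aut_mul g h : tree_aut d :=
  @TreeAut d (h \o g) (aut_inv g \o aut_inv h)
    (can_comp (@aut_funK d h) (@aut_funK d g))
    (can_comp (@aut_invK d g) (@aut_invK d h))
    (aut_mul_adj g h) (aut_mul_root g h).

Fact aut_mulA : associative aut_mul.
Proof. by move=> f g h; apply: tree_autP. Qed.
Fact aut_mul1 : left_id aut_one aut_mul.
Proof. by move=> g; apply: tree_autP. Qed.
Fact aut_mulr1 : right_id aut_one aut_mul.
Proof. by move=> g; apply: tree_autP. Qed.
Fact aut_mulV : left_inverse aut_one aut_invg aut_mul.
Proof. by move=> g; apply: tree_autP => u; exact: aut_invK. Qed.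
Fact aut_mulrV : right_inverse aut_one aut_invg aut_mul.
Proof. by move=> g; apply: tree_autP => u; exact: aut_funK. Qed.

End AutGroup.

HB.instance Definition _ d := isGroup.Build (tree_aut d)
  (@aut_mulA d) (@aut_mul1 d) (@aut_mulr1 d) (@aut_mulV d) (@aut_mulrV d).

Lemma adj_rcons d (u : seq 'I_d) x : adj u (rcons u x).
Proof. by apply/orP; left; apply/existsP; exists x. Qed.

Lemma adj_cat d (u v w : seq 'I_d) : adj (u ++ v) (u ++ w) = adj v w.
Proof.
rewrite /adj; congr (_ || _); apply: eq_existsb => x;
  by rewrite rcons_cat eqseq_cat // eqxx.
Qed.

Section Sections.
Variable d : nat.
Implicit Types (g : tree_aut d) (u v : seq 'I_d).

Lemma aut_rcons g u x : exists y, g (rcons u x) = rcons (g u) y.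
Proof.
elim/last_ind: u x => [|u z IHu] x.
  have := adj_rcons [::] x; rewrite -(aut_adj g) aut_root /=.
  by case/orP=> /existsP[y /eqP]; [exists y | case: (g _)].
have := adj_rcons (rcons u z) x; rewrite -(aut_adj g).
case/orP=> /existsP[y /eqP gy]; first by exists y.
have [t gt] := IHu z; move: gy; rewrite gt => /rcons_inj[gu _].
have /(congr1 size) := can_inj (@aut_funK d g) gu.
by rewrite !size_rcons => /eqP; rewrite -{1}[size u]addn0 -addn2 eqn_add2l.
Qed.

Lemma size_aut g u : size (g u) = size u.
Proof.
elim/last_ind: u => [|u x IHu]; first by rewrite aut_root.
by have [y ->] := aut_rcons g u x; rewrite !size_rcons IHu.
Qed.

Definition section_fun g u v := drop (size u) (g (u ++ v)).

Lemma section_funE g u v : g (u ++ v) = g u ++ section_fun g u v.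
Proof.
rewrite -{1}(cat_take_drop (size u) (g (u ++ v))); congr (_ ++ _).
elim/last_ind: v => [|v x IHv]; first by rewrite cats0 -(size_aut g) take_size.
rewrite -rcons_cat; have [y ->] := aut_rcons g (u ++ v) x.
by rewrite -cats1 takel_cat // size_aut size_cat leq_addr.
Qed.

Lemma section_funK g u : cancel (section_fun g u) (section_fun (aut_invg g) (g u)).
Proof.
move=> v; rewrite {1}/section_fun -section_funE /= aut_funK.
by rewrite size_aut drop_size_cat.
Qed.

Lemma section_invK g u : cancel (section_fun (aut_invg g) (g u)) (section_fun g u).
Proof.
move=> v; rewrite {1}/section_fun -{2}(aut_funK g u).
rewrite -[aut_inv g (g u)]/(aut_invg g (g u)) -section_funE /= aut_invK.
by rewrite -(size_aut g) drop_size_cat.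
Qed.

Lemma section_adj g u v w : adj (section_fun g u v) (section_fun g u w) = adj v w.
Proof. by rewrite -(adj_cat (g u)) -!section_funE aut_adj adj_cat. Qed.

Lemma section_root g u : section_fun g u [::] = [::].
Proof. by rewrite /section_fun cats0 -(size_aut g) drop_size. Qed.

Definition section g u : tree_aut d :=
  TreeAut (section_funK g u) (section_invK g u) (section_adj g u)
    (section_root g u).

Lemma sectionE g u v : g (u ++ v) = g u ++ section g u v.
Proof. exact: section_funE. Qed.

End Sections.

Section Generators.
Variable d : nat.
Implicit Types (i x : 'I_d) (w : seq 'I_d).

(* ordS i is i + 1 modulo d, so that the last generator, which swaps the last *)
(* and the first letters, is covered by the same formula as the others.       *)
Fixpoint gen_fun i w : seq 'I_d :=
  if w is x :: v then
    if x == i then ordS i :: gen_fun i v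
    else if x == ordS i then i :: gen_fun (ordS i) v
    else x :: v
  else [::].

Fixpoint gen_inv i w : seq 'I_d :=
  if w is x :: v then
    if x == ordS i then i :: gen_inv i v
    else if x == i then ordS i :: gen_inv (ordS i) v
    else x :: v
  else [::].

Lemma gen_funK i : cancel (gen_fun i) (gen_inv i).
Proof.
move=> w; elim: w i => [|x v IHv] i //=.
have [->|xi] := eqVneq x i; first by rewrite /= eqxx IHv.
have [xSi|xSi] /= := eqVneq x (ordS i); last by rewrite /= (negPf xSi) (negPf xi).
by rewrite -{1}xSi eq_sym (negPf xi) eqxx IHv -xSi.
Qed.

Lemma gen_invK i : cancel (gen_inv i) (gen_fun i).
Proof.
move=> w; elim: w i => [|x v IHv] i //=.
have [->|xSi] := eqVneq x (ordS i); first by rewrite /= eqxx IHv.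
have [xi|xi] /= := eqVneq x i; last by rewrite /= (negPf xi) (negPf xSi).
by subst x; rewrite eq_sym (negPf xSi) eqxx IHv.
Qed.

Lemma gen_fun_rcons i w x : exists y, gen_fun i (rcons w x) = rcons (gen_fun i w) y.
Proof.
elim: w i => [|z w IHw] i /=; last first.
  case: ifP => _; first by have [y ->] := IHw i; exists y.
  by case: ifP => _; [have [y ->] := IHw (ordS i); exists y | exists x].
case: ifP => _; first by exists (ordS i).
by case: ifP => _; [exists i | exists x].
Qed.

Lemma size_gen_fun i w : size (gen_fun i w) = size w.
Proof.
elim: w i => //= x w IHw i.
by case: ifP => _; [|case: ifP => _] => /=; rewrite ?IHw.
Qed.

Lemma gen_child i u v :
  [exists x, gen_fun i v == rcons (gen_fun i u) x] = [exists x, v == rcons u x].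
Proof.
apply/existsP/existsP=> -[x /eqP]; last first.
  by move=> ->; have [y ->] := gen_fun_rcons i u x; exists y.
elim/last_ind: v => [|v z _]; first by case: (gen_fun i u).
have [y ->] := gen_fun_rcons i v z => /rcons_inj[/(can_inj (gen_funK i)) -> _].
by exists z.
Qed.

Lemma gen_adj i u v : adj (gen_fun i u) (gen_fun i v) = adj u v.
Proof. by rewrite /adj !gen_child. Qed.

Definition gen i : tree_aut d :=
  TreeAut (gen_funK i) (gen_invK i) (gen_adj i) erefl.

End Generators.

Section GroupG.
Variable d : nat.
Local Open Scope group_scope.

Definition is_subgroup (H : set (tree_aut d)) : Prop :=
  H 1 /\ forall g h, H g -> H h -> H (g / h).

Definition Gd : set (tree_aut d) := smallest is_subgroup (range (@gen d)).

(* The letter (i, b) is a_i if b = false and a_i^-1 if b = true. *)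
Definition letter (l : 'I_d * bool) : tree_aut d :=
  if l.2 then (gen l.1)^-1 else gen l.1.

Definition word_eval (w : seq ('I_d * bool)) : tree_aut d :=
  \prod_(l <- w) letter l.

Definition word_expsum (w : seq ('I_d * bool)) : int :=
  (\sum_(l <- w) (-1) ^+ l.2)%R.

(* The value is that of some word representing g; it does not depend on the *)
(* word when d is odd, and it is 0 by convention if g is not in Gd.          *)
Definition expsum (g : tree_aut d) : int :=
  xget 0%R [set word_expsum w | w in [set w | word_eval w = g]].

Lemma Gd_wordP g : Gd g <-> exists w, word_eval w = g.
Proof.
split=> [|[w <-] H [[H1 HV] genH]]; last first.
  have HVr x : H x -> H x^-1 by move=> Hx; rewrite -[x^-1]mul1g; apply: HV.
  rewrite /word_eval; elim/big_ind: _ => //.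
    by move=> x y Hx /HVr Hy; rewrite -[y]invgK; apply: HV.
  move=> [i b] _; have Hi : H (gen i) by apply: genH; exists i.
  by rewrite /letter; case: b => //=; apply: HVr.
apply: (smallest_sub (X := [set g | exists w, word_eval w = g])); last first.
  by move=> _ [i _ <-]; exists [:: (i, false)]; rewrite /word_eval big_seq1.
split=> [|_ _ [v <-] [w <-]]; first by exists [::]; rewrite /word_eval big_nil.
exists (v ++ rev [seq (l.1, ~~ l.2) | l <- w]).
rewrite /word_eval big_cat -map_rev big_map; congr (_ * _).
rewrite -[w in RHS]revK -prodgV; apply: eq_bigr => -[i []] _ //=.
by rewrite /letter /= invgK.
Qed.

Lemma expsumP g : Gd g -> exists2 w, word_eval w = g & expsum g = word_expsum w.
Proof.
move=> /Gd_wordP[w wg]; rewrite /expsum.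
case: xgetP => [_ -> [v vg <-]|/(_ (word_expsum w))[]]; last by exists w.
by exists v.
Qed.

End GroupG.

Section Psi.
Variable d : nat.

(* The words of length k, in lexicographic order. *)
Fixpoint level (k : nat) : seq (seq 'I_d) :=
  if k is k'.+1 then [seq x :: w | x <- enum 'I_d, w <- level k']
  else [:: [::]].

Lemma size_level k : size (level k) == (d ^ k)%N.
Proof.
elim: k => [|k /eqP IHk] //=.
by rewrite size_allpairs size_enum_ord IHk expnS.
Qed.

Lemma mem_level k u : (u \in level k) = (size u == k).
Proof.
elim: k u => [|k IHk] u; first by rewrite inE size_eq0.
apply/allpairsP/idP=> [[[x w] /= [_]]|].
  by rewrite IHk => wk ->; rewrite /= eqSS.
case: u => // x w; rewrite eqSS -IHk => wk.
by exists (x, w); rewrite mem_enum.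
Qed.

Lemma sorted_level k : sorted (fun u v : seqlexi 'I_d => (u < v)%O) (level k).
Proof.
apply/pairwise_sorted; elim: k => [|k IHk] //=.
have: pairwise (fun x y : 'I_d => x < y)%O (enum 'I_d).
  have := iota_ltn_sorted 0 d; rewrite -val_enum_ord sorted_map.
  by rewrite sorted_pairwise // => x y z; apply: ltn_trans.
elim: (enum 'I_d) => //= x s IHs /andP[/allP xs /IHs{}IHs].
rewrite pairwise_cat IHs andbT; apply/andP; split.
  apply/allrelP => _ _ /mapP[u _ ->] /allpairsP[[y v] /= [ys _ ->]].
  by have xy := xs _ ys; rewrite ltxi_cons ltW //= leNgt xy.
rewrite pairwise_map; apply: sub_pairwise IHk => u v /= uv.
by rewrite ltxi_cons lexx.
Qed.

Definition level_tuple k : (d ^ k).-tuple (seq 'I_d) := Tuple (size_level k).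

Definition St (k : nat) : set (tree_aut d) :=
  [set g | Gd g /\ forall u, size u = k -> g u = u].

(* Only the values on St k matter. *)
Definition psi (k : nat) (g : tree_aut d) : (d ^ k).-tuple (tree_aut d) :=
  [tuple of [seq section g u | u <- level_tuple k]].

End Psi.

(* Main.v *)
Require Import Defs.
From mathcomp Require Import all_boot all_order all_algebra perm.
From mathcomp Require Import boolp classical_sets zify.

(** Write [a_i] for [gen i] and let indices run modulo [d].

    Everything reduces to the first level: a family [f] of elements of the
    group, indexed by the letters, is the family of sections of some element
    that fixes all letters if and only if its exponent sums add up to a
    multiple of 4. Taking sections at all letters doubles the exponent sum
    ([sum_expsum_section]), and an element fixing all letters has even
    exponent sum because every generator acts on the letters as a
    transposition ([expsum_even]); this gives one direction. For level [k + 1],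
    the sections at the letters are elements [g x] fixing level [k], and the
    exponent sums below the letter [x] add up to [2 ^ k] times that of [g x];
    so the condition modulo 4 on the [g x] is the condition modulo [2 ^ (k + 2)]
    on the whole family, and induction on [k] concludes
    ([realizable_sections]).

    The converse on the first level ([liftable_of_expsum]) has two halves.
    First, an element with exponent sum 0 may be put at one letter, with the
    identity at all others ([rigid_expsum0]). The elements that can be put at a
    given letter form a subgroup, which is normal because the stabiliser of a
    letter projects onto the whole group ([self_replicating]) and is the same
    for all letters. The failure of the braid relation between [a_i] and
    [a_(i+1)] is concentrated at one letter, and puts a conjugate of
    [a_i a_(i+2)^-1] there. As [d] is odd, steps of length 2 connect the cycle
    of indices, hence all generators agree modulo this normal subgroup, and
    only the exponent sum survives in the quotient.
    Second, every integer vector with sum divisible by 4 is the vector of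
    exponent sums of the sections of some element fixing the letters
    ([realizedP]). The squares [a_i ^ 2] give [2 (e_i + e_(i+1))]. Both
    [a_i ... a_(i+d-2)] and [a_(i+1) ... a_(i+d-1)] rotate the letters
    backwards by one step, and their quotient gives
    [(d - 2) (e_i - e_(i+1))]. For odd [d] these vectors generate the lattice.

    The exponent sum is well defined by a minimality argument
    ([word_eval1_expsum]): in a shortest word for the identity with
    nonzero exponent sum, the sections at the letters are words for the
    identity that are no longer, and whose exponent sums add up to twice the
    original one. All sections of smaller length have exponent sum 0; if there
    is a single section of full length, its exponent sum is doubled, which
    cannot go on forever since the length bounds it. Two sections of full
    length occur only for powers of one generator, and then passing to a
    section leaves this case. *)

Set Implicit Arguments.
Unset Strict Implicit.
Unset Printing Implicit Defensive.

Import Order.TTheory GRing.Theory Num.Theory.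
Local Open Scope classical_set_scope.
Local Open Scope ring_scope.

(** * The cyclic successor on the letters *)
Section CyclicSuccessor.
Variable d : nat.
Implicit Types i x y : 'I_d.

Lemma val_iter_ordS n i : iter n (@ordS d) i = ((i + n) %% d)%N :> nat.
Proof.
elim: n => [|n IHn] /=; first by rewrite addn0 modn_small.
by rewrite IHn -addn1 modnDml addn1 addnS.
Qed.

Lemma iter_ordS_period i : iter d (@ordS d) i = i.
Proof. by apply: val_inj; rewrite /= val_iter_ordS modnDr modn_small. Qed.

Lemma iter_ordS_neq n i : (0 < n < d)%N -> iter n (@ordS d) i != i.
Proof.
move=> /andP[n0 nd]; apply/eqP => /(congr1 val) /=; rewrite val_iter_ordS => e.
have : i + n == i + 0 %[mod d] by rewrite e addn0 modn_small.
by rewrite eqn_modDl mod0n modn_small //; case: n n0 {nd e}.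
Qed.

Lemma ordS_iterP i j : exists2 n, (n < d)%N & j = iter n (@ordS d) i.
Proof.
have d0 : (0 < d)%N := leq_ltn_trans (leq0n i) (ltn_ord i).
exists ((j + (d - i)) %% d)%N; first by rewrite ltn_mod.
apply: val_inj; rewrite /= val_iter_ordS modnDmr.
have -> : (i + (j + (d - i)) = j + d)%N by have := ltn_ord i; lia.
by rewrite modnDr modn_small.
Qed.

Lemma ordS_inj : injective (@ordS d).
Proof.
case: d iter_ordS_period => [|n] per; first by move=> [].
by move=> x y e; rewrite -(per x) -(per y) !iterSr e.
Qed.

Lemma ordS_surj i : exists j, i = ordS j.
Proof.
case: d i iter_ordS_period => [|n] i per; first by case: i.
by exists (iter n (@ordS _) i); rewrite -iterS per.
Qed.

Lemma cyclic_connected (P : 'I_d -> 'I_d -> Prop) :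
  (forall i, P i i) -> (forall i j k, P i j -> P j k -> P i k) ->
  (forall i, P i (ordS i)) -> forall i j, P i j.
Proof.
move=> P1 PM PS i j; have [n _ ->] := ordS_iterP i j.
by elim: n => //= n IHn; apply: PM IHn _.
Qed.

(** For odd [d], the successor is reached after [(d + 1) / 2] steps of
    length 2. *)
Lemma odd_cyclic_connected (P : 'I_d -> 'I_d -> Prop) : odd d ->
  (forall i, P i i) -> (forall i j k, P i j -> P j k -> P i k) ->
  (forall i, P i (ordS (ordS i))) -> forall i j, P i j.
Proof.
move=> hodd P1 PM PSS; apply: cyclic_connected => // i.
have even m : P i (iter m.*2 (@ordS d) i).
  by elim: m => //= m IHm; apply: PM IHm _.
have := even d.+1./2.
have -> : d.+1./2.*2 = d.+1 by have := odd_double_half d.+1; rewrite /= hodd.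
by rewrite iterS iter_ordS_period.
Qed.

Hypothesis hd : (3 <= d)%N.

Lemma ordS_neq i : ordS i != i.
Proof. by rewrite (@iter_ordS_neq 1) //=; lia. Qed.

Lemma ordSS_neq i : ordS (ordS i) != i.
Proof. by rewrite (@iter_ordS_neq 2) //=; lia. Qed.

End CyclicSuccessor.

(** * Wreath recursion on words *)

Section Words.
Variable d : nat.
Implicit Types (l : 'I_d * bool) (w : seq ('I_d * bool)) (x y : 'I_d).

Definition letter_perm l : {perm 'I_d} := tperm l.1 (ordS l.1).

(** Words are used for sections, rather than group elements, in order to keep
    track of lengths. The section of [a_i^-1] at [x] is the inverse of the
    section of [a_i] at the preimage of [x], whence the transposed index in the
    inverse case. *)
Definition letter_sec l x : seq ('I_d * bool) :=
  if x \in [:: l.1; ordS l.1]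
  then [:: (if l.2 then letter_perm l x else x, l.2)] else [::].

Definition word_perm w : {perm 'I_d} := (\prod_(l <- w) letter_perm l)%g.

Fixpoint word_sec w x : seq ('I_d * bool) :=
  if w is l :: w' then letter_sec l x ++ word_sec w' (letter_perm l x)
  else [::].

Lemma word_eval_nil : word_eval (Nil ('I_d * bool)) = 1%g.
Proof. exact: big_nil. Qed.

Lemma word_eval_cons l w : word_eval (l :: w) = (letter l * word_eval w)%g.
Proof. exact: big_cons. Qed.

Lemma word_eval_cat w1 w2 :
  word_eval (w1 ++ w2) = (word_eval w1 * word_eval w2)%g.
Proof. exact: big_cat. Qed.

Lemma word_perm_cons l w x :
  word_perm (l :: w) x = word_perm w (letter_perm l x).
Proof. by rewrite /word_perm big_cons permM. Qed.

Lemma word_expsum_cons l w :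
  word_expsum (l :: w) = (-1) ^+ l.2 + word_expsum w.
Proof. exact: big_cons. Qed.

Lemma word_expsum_nil : word_expsum (Nil ('I_d * bool)) = 0.
Proof. exact: big_nil. Qed.

Lemma word_expsum_cat w1 w2 :
  word_expsum (w1 ++ w2) = word_expsum w1 + word_expsum w2.
Proof. exact: big_cat. Qed.

Lemma mul_autE (g h : tree_aut d) u : (g * h)%g u = h (g u).
Proof. by []. Qed.

Lemma letterE l x v :
  letter l (x :: v) = letter_perm l x :: word_eval (letter_sec l x) v.
Proof.
case: l => i b; rewrite /letter_sec /letter_perm /= !inE.
have [->|xi] := eqVneq x i.
  rewrite tpermL /= word_eval_cons word_eval_nil mulg1 /letter.
  case: b => /=; rewrite ?eqxx //.
  by case: eqP => // e; rewrite -e.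
have [->|xS] /= := eqVneq x (ordS i).
  rewrite tpermR /= word_eval_cons word_eval_nil mulg1 /letter.
  case: b => /=; rewrite ?eqxx //.
  by case: eqP => // e; rewrite e.
rewrite tpermD ?[_ == x]eq_sym // word_eval_nil /letter.
by case: b => /=; rewrite (negPf xi) (negPf xS).
Qed.

Lemma word_evalE w x v :
  word_eval w (x :: v) = word_perm w x :: word_eval (word_sec w x) v.
Proof.
elim: w x v => [|l w IHw] x v /=.
  by rewrite /word_perm big_nil perm1 word_eval_nil.
by rewrite word_eval_cons mul_autE letterE IHw word_perm_cons word_eval_cat.
Qed.

Lemma size_letter_sec l x : (size (letter_sec l x) <= 1)%N.
Proof. by rewrite /letter_sec; case: ifP. Qed.

Lemma size_word_sec w x : (size (word_sec w x) <= size w)%N.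
Proof.
elim: w x => //= l w IHw x; rewrite size_cat.
by have := size_letter_sec l x; have := IHw (letter_perm l x); lia.
Qed.

Lemma word_sec_eval1 w x : word_eval w = 1%g -> word_eval (word_sec w x) = 1%g.
Proof.
move=> w1; apply: tree_autP => v.
by have := word_evalE w x v; rewrite w1 => -[_ <-].
Qed.

Lemma abs_word_expsum w : `|word_expsum w| <= (size w)%:Z.
Proof.
elim: w => [|[i b] w IHw]; first by rewrite word_expsum_nil.
by rewrite word_expsum_cons /=; case: b; rewrite ?expr0 ?expr1; lia.
Qed.

Hypothesis hd : (3 <= d)%N.

Lemma sum_letter_sec l : \sum_x word_expsum (letter_sec l x) = (-1) ^+ l.2 *+ 2.
Proof.
have S := ordS_neq hd l.1.
have E x : word_expsum (letter_sec l x)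
           = if x \in [:: l.1; ordS l.1] then (-1) ^+ l.2 else 0.
  rewrite /letter_sec; case: ifP => _; last exact: word_expsum_nil.
  by rewrite word_expsum_cons word_expsum_nil addr0.
rewrite (bigD1 l.1) //= (bigD1 (ordS l.1)) //= big1 => [|x /andP[x1 x2]].
  by rewrite !E !inE !eqxx orbT addr0 mulr2n.
by rewrite E !inE (negPf x1) (negPf x2).
Qed.

Lemma sum_word_sec w : \sum_x word_expsum (word_sec w x) = word_expsum w *+ 2.
Proof.
elim: w => [|l w IHw] /=.
  by rewrite big1 => [|x _]; rewrite word_expsum_nil.
under eq_bigr do rewrite word_expsum_cat.
rewrite big_split /= sum_letter_sec word_expsum_cons mulrnDl; congr (_ + _).
by rewrite -IHw [RHS](reindex_inj (@perm_inj _ (letter_perm l))).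
Qed.

Lemma word_perm_odd w : (word_perm w : bool) = odd `|word_expsum w|.
Proof.
elim: w => [|l w IHw]; first by rewrite /word_perm big_nil odd_perm1 word_expsum_nil.
rewrite /word_perm big_cons odd_permM -/(word_perm w) IHw odd_tperm.
rewrite eq_sym ordS_neq // word_expsum_cons.
by case: l => i [] /=; rewrite ?expr0 ?expr1; lia.
Qed.

Lemma adjacent_pair_unique i j x y : x != y ->
  x \in [:: i; ordS i] -> y \in [:: i; ordS i] ->
  x \in [:: j; ordS j] -> y \in [:: j; ordS j] -> j = i.
Proof.
have /eqP S1 := ordSS_neq hd i; have /eqP S2 := ordSS_neq hd j.
move=> /eqP xy; rewrite !inE.
by do 4![case/orP => /eqP ?]; subst; try by []; congruence.
Qed.

(** A section of [w] at a letter [x] has full length when every letter of [w]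
    moves the image of [x] so far. If [x] and [y] are both moved by every
    step, they stay the two letters swapped by one and the same generator,
    which they determine as soon as there are three letters. *)
Lemma two_full_sections w x y : x != y ->
  size (word_sec w x) = size w -> size (word_sec w y) = size w ->
  exists i, all (fun l => l.1 == i) w.
Proof.
move=> xy fx fy.
case: w fx fy => [|l w] fx fy; first by exists x.
exists l.1; rewrite /= eqxx /=.
have full l' w' z : size (word_sec (l' :: w') z) = size (l' :: w') ->
    z \in [:: l'.1; ordS l'.1] /\
    size (word_sec w' (letter_perm l' z)) = size w'.
  rewrite /= size_cat /letter_sec; have := size_word_sec w' (letter_perm l' z).
  by case: ifP => _ /=; lia.
have stay (i z : 'I_d) : z \in [:: i; ordS i] -> tperm i (ordS i) z \in [:: i; ordS i].
  by rewrite !inE => /orP[]/eqP->; rewrite ?tpermL ?tpermR eqxx ?orbT.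
move: fx fy => /full[lx fx] /full[ly fy].
move: (stay _ _ lx) (stay _ _ ly) => {lx ly}.
have {xy} : letter_perm l x != letter_perm l y by rewrite (inj_eq perm_inj).
rewrite /letter_perm in fx fy *; move: (tperm _ _ x) (tperm _ _ y) fx fy.
elim: w => //= l' w IHw {}x {}y fx fy xy lx ly.
move: (fx) (fy) => /full[l'x fx'] /full[l'y fy'].
have e : l'.1 = l.1 by exact: (adjacent_pair_unique xy).
rewrite e eqxx /=; apply: (IHw (letter_perm l' x) (letter_perm l' y)) => //.
- by rewrite (inj_eq perm_inj).
- by rewrite /letter_perm e; apply: stay.
- by rewrite /letter_perm e; apply: stay.
Qed.

Lemma letter_mulV i b : (letter (i, b) * letter (i, ~~ b) = 1 :> tree_aut d)%g.
Proof. by rewrite /letter; case: b => /=; rewrite ?mulgV ?mulVg. Qed.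

Lemma reduce_constant_word i w : all (fun l => l.1 == i) w ->
  exists n b, [/\ (n <= size w)%N, word_eval w = word_eval (nseq n (i, b))
    & word_expsum w = word_expsum (nseq n (i, b))].
Proof.
elim: w => [_|[j b] w IHw /= /andP[/eqP-> /IHw[n [c [nw ew sw]]]]].
  by exists 0%N, true.
case: n nw ew sw => [|n] nw ew sw.
  by exists 1%N, b; rewrite /= word_eval_cons word_expsum_cons ew sw
    -word_eval_cons -word_expsum_cons.
have [->|bc] := eqVneq b c.
  by exists n.+2, c; rewrite word_eval_cons word_expsum_cons ew sw
    -word_eval_cons -word_expsum_cons.
have {bc}cb : c = ~~ b by move: bc; clear; case: b c => [] [].
exists n, c; split; first by lia.
  rewrite word_eval_cons ew /= word_eval_cons mulgA.
  by rewrite cb letter_mulV mul1g.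
by rewrite word_expsum_cons sw word_expsum_cons addrA cb signrN /= subrr add0r.
Qed.

(** Each factor swaps [i] and [i + 1], and its section at either of them is a
    single letter with the same sign. *)
Lemma sec_nseq n i b x : x \in [:: i; ordS i] ->
  size (word_sec (nseq n (i, b)) x) = n /\
  word_expsum (word_sec (nseq n (i, b)) x) = word_expsum (nseq n (i, b)).
Proof.
elim: n x => [//|n IHn] x ix.
have /IHn[s e] : letter_perm (i, b) x \in [:: i; ordS i].
  move: ix; rewrite !inE /letter_perm => /orP[]/eqP->.
    by rewrite tpermL eqxx orbT.
  by rewrite tpermR eqxx.
rewrite /= /letter_sec ix /= s; split=> //.
by rewrite !word_expsum_cons e.
Qed.

Lemma word_eval1_perm w x : word_eval w = 1%g -> word_perm w x = x.
Proof. by move=> w1; have := word_evalE w x [::]; rewrite w1 => -[]. Qed.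

Definition one_index w := exists i, all (fun l => l.1 == i) w.

(** For [b = false] this section is [a_i a_(i+1) a_i ...]; it is used to leave
    the case of two sections of full length without changing the length or the
    exponent sum. *)
Lemma sec_power_two_indices n i b :
  ~ one_index (word_sec (nseq n.+2 (i, b)) i).
Proof.
case=> j /=; rewrite /letter_sec /letter_perm /= inE eqxx /= tpermL tpermR.
rewrite !inE eqxx orbT /= => /and3P[/eqP<- + _].
by have := ordS_neq hd i; case: b => /negPf n1; rewrite // ?n1 // eq_sym n1.
Qed.

(** The outer induction is on the length [n] of the word, the inner one on
    [n] minus the absolute value of the exponent sum: the latter doubles in the
    only section that can have a nonzero exponent sum, and stays bounded by
    the length. *)
Theorem word_eval1_expsum w : word_eval w = 1%g -> word_expsum w = 0.
Proof.
have [n] := ubnP (size w); elim: n w => // n IHn w; rewrite ltnS leq_eqVlt.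
case/predU1P=> [sw|/IHn] // w1.
(* If [v] is not freely reduced, the reduced word is shorter. Otherwise [v]
   is a power of one generator, and [v'] is its section at [i]. *)
have to_two_indices v : size v = n -> word_eval v = 1%g -> one_index v ->
    word_expsum v = 0 \/ exists v', [/\ size v' = n, word_eval v' = 1%g,
      ~ one_index v' & word_expsum v' = word_expsum v].
  move=> sv v1 [i vi]; have [m [b [mn em sm]]] := reduce_constant_word vi.
  move: em; rewrite v1 => /esym em.
  move: mn; rewrite sv leq_eqVlt => /predU1P[mn|mn]; last first.
    by left; rewrite sm; apply: IHn em; rewrite size_nseq.
  have ii : i \in [:: i; ordS i] by rewrite inE eqxx.
  have [ss se] := sec_nseq m b ii.
  case: m em {mn} ss se sm (mn) => [|[|m]] em ss se sm mn.
  - by left; rewrite sm word_expsum_nil.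
  - have := word_eval1_perm i em; rewrite word_perm_cons /word_perm big_nil perm1.
    by rewrite /letter_perm tpermL => /eqP; rewrite (negPf (ordS_neq hd i)).
  right; exists (word_sec (nseq m.+2 (i, b)) i); split.
  - by rewrite ss.
  - exact: word_sec_eval1.
  - exact: sec_power_two_indices.
  - by rewrite se sm.
have two_indices v : size v = n -> word_eval v = 1%g -> ~ one_index v ->
    word_expsum v = 0.
  have [m] := ubnP (n.+1 - `|word_expsum v|)%N.
  elim: m v => // m IHm v; rewrite ltnS => vm sv v1 v2.
  have [/eqP//|v0] := boolP (word_expsum v == 0).
  have : word_expsum v *+ 2 == 0; last by rewrite mulrn_eq0 => /eqP.
  rewrite -sum_word_sec.
  have [/existsP[x /eqP fx]|/existsPn nf] :=
    boolP [exists x, size (word_sec v x) == n]; last first.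
    rewrite big1 // => x _; apply: IHn; last exact: word_sec_eval1.
    by rewrite ltn_neqAle nf -sv size_word_sec.
  have others y : y != x -> word_expsum (word_sec v y) = 0.
    move=> yx; apply: IHn; last exact: word_sec_eval1.
    rewrite ltn_neqAle -{2}sv size_word_sec andbT; apply/eqP => fy; apply: v2.
    by apply: (two_full_sections yx); rewrite ?fx ?fy.
  have double : word_expsum (word_sec v x) = word_expsum v *+ 2.
    by rewrite -sum_word_sec (bigD1 x) //= big1 ?addr0.
  rewrite (bigD1 x) //= big1 // addr0; apply/eqP.
  have x1 := word_sec_eval1 x v1.
  have grow v' : size v' = n -> word_eval v' = 1%g -> ~ one_index v' ->
      word_expsum v' = word_expsum v *+ 2 -> word_expsum v' = 0.
    move=> sv' v'1 v'2 e; apply: IHm => //.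
    have := abs_word_expsum v'; rewrite sv' e; lia.
  have [c|c] := pselect (one_index (word_sec v x)); last exact: grow.
  have [//|[v' [sv' v'1 v'2 e]]] := to_two_indices _ fx x1 c.
  by rewrite -e; apply: grow; rewrite // e double.
have [c|c] := pselect (one_index w); last exact: two_indices.
have [//|[v' [sv' v'1 v'2 <-]]] := to_two_indices _ sw w1 c.
exact: two_indices.
Qed.
End Words.

(** * The exponent sum as a homomorphism *)

Section ExponentSum.
Variable d : nat.
Implicit Types (g h : tree_aut d) (w : seq ('I_d * bool)).

Lemma Gd_gen i : Gd (@gen d i).
Proof.
by apply/Gd_wordP; exists [:: (i, false)]; rewrite word_eval_cons word_eval_nil mulg1.
Qed.

Lemma Gd1 : Gd (1 : tree_aut d)%g.
Proof. by apply/Gd_wordP; exists [::]; exact: word_eval_nil. Qed.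

Lemma GdM g h : Gd g -> Gd h -> Gd (g * h)%g.
Proof.
move=> /Gd_wordP[v <-] /Gd_wordP[w <-]; apply/Gd_wordP.
by exists (v ++ w); exact: word_eval_cat.
Qed.

Definition inv_word w := rev [seq (l.1, ~~ l.2) | l <- w].

Lemma inv_wordE w : word_eval (inv_word w) = (word_eval w)^-1%g.
Proof.
elim: w => [|[i b] w IHw]; first by rewrite word_eval_nil invg1.
rewrite word_eval_cons invgM -IHw /inv_word /= rev_cons -cats1 word_eval_cat.
congr (_ * _)%g; rewrite word_eval_cons word_eval_nil mulg1.
by case: b; rewrite /letter /= ?invgK.
Qed.

Lemma inv_word_expsum w : word_expsum (inv_word w) = - word_expsum w.
Proof.
elim: w => [|[i b] w IHw]; first by rewrite /word_expsum !big_nil oppr0.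
rewrite /inv_word /= rev_cons -cats1 word_expsum_cat -/(inv_word w) IHw.
by rewrite !word_expsum_cons word_expsum_nil signrN /= addr0 opprD addrC.
Qed.

Lemma GdV g : Gd g -> Gd (g^-1)%g.
Proof.
by move=> /Gd_wordP[w <-]; apply/Gd_wordP; exists (inv_word w); exact: inv_wordE.
Qed.

Lemma Gd_section g x : Gd g -> Gd (section g [:: x]).
Proof.
move=> /Gd_wordP[w <-]; apply/Gd_wordP; exists (word_sec w x).
apply: tree_autP => v; have := word_evalE w x v.
rewrite -cat1s sectionE -[word_eval w [:: x]]/(word_eval w (x :: [::])).
by rewrite word_evalE aut_root => -[].
Qed.

Hypothesis hd : (3 <= d)%N.

Lemma expsum_word w : expsum (word_eval w) = word_expsum w.
Proof.
have [|v vw ->] := @expsumP _ (word_eval w); first by apply/Gd_wordP; exists w.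
apply/eqP; rewrite -subr_eq0 -inv_word_expsum -word_expsum_cat; apply/eqP.
by apply: word_eval1_expsum => //; rewrite word_eval_cat inv_wordE vw mulgV.
Qed.

Lemma expsumM g h : Gd g -> Gd h -> expsum (g * h)%g = expsum g + expsum h.
Proof.
move=> /Gd_wordP[v <-] /Gd_wordP[w <-].
by rewrite -word_eval_cat !expsum_word word_expsum_cat.
Qed.

Lemma expsumV g : Gd g -> expsum (g^-1)%g = - expsum g.
Proof. by move=> /Gd_wordP[v <-]; rewrite -inv_wordE !expsum_word inv_word_expsum. Qed.

Lemma expsum_gen i : expsum (@gen d i) = 1.
Proof.
have -> : gen i = word_eval [:: (i, false)] by rewrite word_eval_cons word_eval_nil mulg1.
by rewrite expsum_word word_expsum_cons word_expsum_nil.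
Qed.

Lemma expsum1 : expsum (1%g : tree_aut d) = 0.
Proof. by rewrite -word_eval_nil expsum_word word_expsum_nil. Qed.

End ExponentSum.

(** * Sections at letters, and families realised by elements fixing the letters *)

Section Sections.
Variable d : nat.
Implicit Types (g h s t : tree_aut d) (x y z : 'I_d).

(** This pairs the image of a letter with the section there, so that both are
    computed together along products and inverses. *)
Definition maps_to g x y h := forall v, g (x :: v) = y :: h v.

Lemma maps_to_section g x : exists y, maps_to g x y (section g [:: x]).
Proof.
have [y gx] := aut_rcons g [::] x; exists y => v.
by rewrite -cat1s sectionE -[[:: x]]/(rcons [::] x) gx aut_root.
Qed.

Lemma maps_to1 x : maps_to 1%g x x 1%g.
Proof. by []. Qed.

Lemma maps_toM g h x y z g' h' :
  maps_to g x y g' -> maps_to h y z h' -> maps_to (g * h)%g x z (g' * h')%g.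
Proof. by move=> gx hy v; rewrite mul_autE gx hy. Qed.

Lemma maps_toV g x y g' : maps_to g x y g' -> maps_to (g^-1)%g y x (g'^-1)%g.
Proof.
move=> gx v; have e : g (x :: (g'^-1)%g v) = y :: v.
  by rewrite gx -mul_autE mulVg.
by rewrite -e -mul_autE mulgV.
Qed.

Lemma maps_to_eq g x y h h' : maps_to g x y h -> h = h' -> maps_to g x y h'.
Proof. by move=> ? <-. Qed.

Lemma maps_to_unique g x y y' h h' :
  maps_to g x y h -> maps_to g x y' h' -> y = y' /\ h = h'.
Proof.
move=> e e'; have E v : y :: h v = y' :: h' v by rewrite -e.
have [-> _] := E [::]; split=> //; apply: tree_autP => v.
by case: (E v).
Qed.

Lemma maps_to_Gd g x y h : Gd g -> maps_to g x y h -> Gd h.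
Proof.
move=> Gg e; have [y' e'] := maps_to_section g x.
by have [_ ->] := maps_to_unique e e'; exact: Gd_section.
Qed.

Lemma gen_self i : maps_to (gen i) i (ordS i) (gen i).
Proof. by move=> v; rewrite /= eqxx. Qed.

Lemma gen_other i x : x != i -> x != ordS i -> maps_to (gen i) x x 1%g.
Proof. by move=> /negPf xi /negPf xS v; rewrite /= xi xS. Qed.

Hypothesis hd : (3 <= d)%N.

Lemma gen_succ i : maps_to (gen i) (ordS i) i (gen (ordS i)).
Proof. by move=> v; rewrite /= eqxx (negPf (ordS_neq hd i)). Qed.

Definition liftable (f : 'I_d -> tree_aut d) :=
  exists2 s, Gd s & forall x, maps_to s x x (f x).

Lemma eq_liftable f f' : f =1 f' -> liftable f -> liftable f'.
Proof. by move=> e [s Gs sx]; exists s => // x; rewrite -e. Qed.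

Lemma liftable1 : liftable (fun=> 1%g).
Proof. by exists 1%g; [exact: Gd1 | move=> x; exact: maps_to1]. Qed.

Lemma liftableM f f' :
  liftable f -> liftable f' -> liftable (fun x => f x * f' x)%g.
Proof.
move=> [s Gs sx] [t Gt tx]; exists (s * t)%g; first exact: GdM.
by move=> x; apply: maps_toM.
Qed.

Lemma liftableV f : liftable f -> liftable (fun x => (f x)^-1)%g.
Proof.
move=> [s Gs sx]; exists (s^-1)%g; first exact: GdV.
by move=> x; apply: maps_toV.
Qed.

Lemma liftable_Gd f x : liftable f -> Gd (f x).
Proof. by move=> [s Gs sx]; exact: maps_to_Gd (sx x). Qed.

(** The elements [g] with [rigid x g] form the rigid stabiliser of the vertex
    [x], identified with its image under the section at [x]. *)
Definition rigid x g := liftable (fun y => if y == x then g else 1%g).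

Lemma rigid1 x : rigid x 1%g.
Proof. by apply: eq_liftable liftable1 => y; case: ifP. Qed.

Lemma rigidM x g h : rigid x g -> rigid x h -> rigid x (g * h)%g.
Proof.
move=> rg rh; apply: eq_liftable (liftableM rg rh) => y.
by case: ifP => //; rewrite mulg1.
Qed.

(** Conjugation by [s] carries what sits at [x] to the image [y] of [x]. *)
Lemma rigid_transport s x y g h : Gd s -> maps_to s x y h -> rigid x g ->
  rigid y (h^-1 * g * h)%g.
Proof.
move=> Gs sx [t Gt tx]; exists (s^-1 * t * s)%g.
  by apply: GdM => //; apply: GdM => //; apply: GdV.
move=> z; have [->|zy] := eqVneq z y.
  apply: (maps_toM _ sx); apply: maps_toM (maps_toV sx) _.
  by have := tx x; rewrite eqxx.
have [z' sz] := maps_to_section (s^-1)%g z.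
have sz' := maps_toV sz; rewrite invgK in sz'.
have z'x : z' != x.
  apply: contra_neq zy => z'x; rewrite z'x in sz'.
  by case: (maps_to_unique sz' sx).
apply: maps_to_eq (maps_toM (maps_toM sz (tx z')) sz') _.
by rewrite (negPf z'x) mulg1 mulgV.
Qed.

End Sections.

(** * Elements of exponent sum zero at a single letter *)

Section Branching.
Variable d : nat.
Hypotheses (hd : (3 <= d)%N) (hodd : odd d).
Implicit Types (g h s t : tree_aut d) (i j x y z : 'I_d).
Local Open Scope group_scope.

Fixpoint run n i : tree_aut d :=
  if n is n'.+1 then gen i * run n' (ordS i) else 1.

(** The letter [i] is pushed one step forward by each factor in turn, and each
    time the section is the factor itself. *)
Lemma run_start n i : maps_to (run n i) i (iter n (@ordS d) i) (run n i).
Proof.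
elim: n i => [|n IHn] i; first exact: maps_to1.
by rewrite iterSr; apply: maps_toM (gen_self i) (IHn _).
Qed.

Lemma runSr n i : run n.+1 i = run n i * gen (iter n (@ordS d) i).
Proof.
elim: n i => [|n IHn] i; first by rewrite /= mulg1 mul1g.
by rewrite [LHS]/= -/(run n.+1 _) IHn mulgA iterSr.
Qed.

Lemma Gd_run n i : Gd (run n i).
Proof.
by elim: n i => [|n IHn] i; [exact: Gd1 | apply: GdM; [exact: Gd_gen|]].
Qed.

Lemma Gd_min (H : tree_aut d -> Prop) :
  H 1 -> (forall g h, H g -> H h -> H (g / h)) -> (forall i, H (gen i)) ->
  forall g, Gd g -> H g.
Proof.
move=> H1 HV Hgen; apply: (@smallest_sub _ (@is_subgroup d)) => //.
by move=> _ [i _ <-].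
Qed.

Definition stab_section i g := exists2 s, Gd s & maps_to s i i g.

Lemma stab_sectionM i g h :
  stab_section i g -> stab_section i h -> stab_section i (g * h).
Proof.
move=> [s Gs si] [t Gt ti]; exists (s * t); first exact: GdM.
exact: maps_toM si ti.
Qed.

Lemma stab_sectionV i g : stab_section i g -> stab_section i g^-1.
Proof.
by move=> [s Gs si]; exists s^-1; [exact: GdV | exact: maps_toV].
Qed.

(** The witness moves [i] to [i + n], applies [a_(i+n)] twice, which returns to
    [i + n] with section [a_(i+n) a_(i+n+1)], and goes back. *)
Lemma stab_section_run2 n i : stab_section i (run n.+2 i / run n i).
Proof.
pose a := @gen d (iter n (@ordS d) i).
exists (run n i * a * a / run n i).
  by do !apply: GdM; rewrite ?/a; do ?[exact: Gd_run | exact: Gd_gen];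
    apply: GdV; exact: Gd_run.
rewrite !runSr; apply: maps_toM (maps_toV (run_start n i)).
apply: maps_toM (gen_succ hd _); apply: maps_toM (gen_self _).
exact: run_start.
Qed.

Lemma stab_section_run_step n i :
  stab_section i (run n i) <-> stab_section i (run n.+2 i).
Proof.
have e := stab_section_run2 n i; split=> en.
  by rewrite -(mulgVK (run n i) (run n.+2 i)); apply: stab_sectionM.
rewrite -[run n i]mul1g -(mulVg (run n.+2 i / run n i)) -mulgA mulgVK.
by apply: stab_sectionM => //; apply: stab_sectionV.
Qed.

(** Even lengths are reached from the empty product, odd ones from the product
    of all [d] generators, which brings the letter [i] once around the cycle;
    this uses that [d] is odd. *)
Lemma stab_section_run n i : (n <= d)%N -> stab_section i (run n i).
Proof.
move=> nd; have shift m k : stab_section i (run k i) <->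
    stab_section i (run (m.*2 + k) i).
  elim: m => // m IHm; rewrite doubleS !addSn IHm.
  exact: stab_section_run_step.
have [on|en] := boolP (odd n); last first.
  rewrite -(odd_double_half n) (negPf en) add0n -[n./2.*2]addn0 -shift.
  by exists 1; [exact: Gd1 | exact: maps_to1].
rewrite (shift (d - n)./2).
have -> : ((d - n)./2.*2 + n = d)%N.
  have := odd_double_half (d - n); rewrite oddB // hodd on /=; lia.
exists (run d i); first exact: Gd_run.
by have := run_start d i; rewrite iter_ordS_period.
Qed.

(** Each generator is a quotient of two consecutive runs from [i]. *)
Lemma self_replicating i g : Gd g -> stab_section i g.
Proof.
apply: Gd_min => [|{}g h ig ih|j].
- by exists 1; [exact: Gd1 | exact: maps_to1].
- by apply: stab_sectionM => //; apply: stab_sectionV.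
have [n nd ->] := ordS_iterP i j.
have -> : gen (iter n (@ordS d) i) = (run n i)^-1 * run n.+1 i.
  by rewrite runSr mulKg.
by apply: stab_sectionM; [apply: stab_sectionV|]; apply: stab_section_run => //; lia.
Qed.

Lemma rigidJ x g h : Gd h -> rigid x g -> rigid x (h^-1 * g * h).
Proof.
by move=> /(self_replicating x)[s Gs sx]; apply: rigid_transport sx.
Qed.

(** Moving from [x] to its successor by [a_x] conjugates the element put there,
    and normality undoes the conjugation. *)
Lemma rigid_letter x y g : rigid x g -> rigid y g.
Proof.
move: x y; apply: cyclic_connected => // [x y z xy yz /xy/yz //|x rx].
have Ga := Gd_gen x.
have := rigidJ (GdV Ga) (rigid_transport Ga (gen_self x) rx).
by rewrite invgK !mulgA mulgV mul1g mulgK.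
Qed.

(** With [a], [b], [c] the generators of indices [i], [i + 1], [i + 2], the
    products [a b a] and [b a b] act alike on the letters and have the same
    sections, except at [i + 1], where these are [b a] and [b c]. *)
Lemma rigid_braid x i : rigid x (gen i / gen (ordS (ordS i))).
Proof.
pose q := ordS i; pose r := ordS q.
pose a := gen i; pose b := gen q; pose c := gen r.
have qi : q != i := ordS_neq hd i.
have rq : r != q := ordS_neq hd q.
have ri : r != i := ordSS_neq hd i.
have [aq bi] : maps_to a r r 1 /\ maps_to b i i 1.
  by split; apply: gen_other; rewrite // eq_sym.
have [ai bq] : maps_to a i q a /\ maps_to b q r b by split; exact: gen_self.
have [aq' br] : maps_to a q i b /\ maps_to b r q c by split; exact: gen_succ.
have Ga : Gd a := Gd_gen i; have Gb : Gd b := Gd_gen q.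
suff : rigid q (b * a / (b * c)).
  move=> /(rigid_letter x)/(rigidJ Gb).
  by rewrite invgM !mulgA mulVg mul1g mulgVK.
exists (a * b * a / (b * a * b)).
  by do ![apply: GdM] => //; apply: GdV; do ![apply: GdM].
move=> z; have [->|zq] := eqVneq z q.
  apply: maps_to_eq (maps_toM (maps_toM (maps_toM aq' bi) ai)
    (maps_toV (maps_toM (maps_toM bq aq) br))) _.
  by rewrite !mulg1.
have [->|zi] := eqVneq z i.
  apply: maps_to_eq (maps_toM (maps_toM (maps_toM ai bq) aq)
    (maps_toV (maps_toM (maps_toM bi ai) bq))) _.
  by rewrite mulg1 mul1g mulgV.
have [->|zr] := eqVneq z r.
  apply: maps_to_eq (maps_toM (maps_toM (maps_toM aq br) aq')
    (maps_toV (maps_toM (maps_toM br aq') bi))) _.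
  by rewrite mulg1 mul1g mulgV.
have az := gen_other zi zq; have bz := gen_other zq zr.
apply: maps_to_eq (maps_toM (maps_toM (maps_toM az bz) az)
    (maps_toV (maps_toM (maps_toM bz az) bz))) _.
by rewrite !mulg1 mulgV.
Qed.

Lemma rigid_gens x i j : rigid x (gen i / gen j).
Proof.
move: i j; apply: odd_cyclic_connected => // [i|i j k rij rjk|i].
- by rewrite mulgV; apply: rigid1.
- by rewrite -(mulgVK (gen j) (gen i)) -mulgA; apply: rigidM.
- exact: rigid_braid.
Qed.

Lemma rigid_letters x i j b : rigid x (letter (i, b) / letter (j, b)).
Proof.
case: b; rewrite /letter /=; last exact: rigid_gens.
rewrite invgK -[gen j](mulgVK (gen i)) mulgA.
exact: rigidJ (Gd_gen i) (rigid_gens x j i).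
Qed.

Lemma rigid_word x j (w : seq ('I_d * bool)) :
  rigid x (word_eval w / word_eval [seq (j, l.2) | l <- w]).
Proof.
elim: w => [|[i b] w IHw] /=; first by rewrite mulgV; apply: rigid1.
rewrite !word_eval_cons; set W := word_eval w in IHw *.
set W' := word_eval _ in IHw *; set l := letter _; set l' := letter _.
have -> : l * W / (l' * W') = (l^-1)^-1 * (W / W') * l^-1 * (l / l').
  by rewrite invgK invgM !mulgA mulgVK.
apply: rigidM; last exact: rigid_letters.
apply: rigidJ => //; apply: GdV; apply/Gd_wordP; exists [:: (i, b)].
by rewrite word_eval_cons word_eval_nil mulg1.
Qed.

(** Replacing all generators in a word by one of them changes nothing modulo the
    rigid stabiliser, and leaves a power whose exponent is the exponent sum. *)
Theorem rigid_expsum0 x g : Gd g -> expsum g = 0%R -> rigid x g.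
Proof.
move=> /Gd_wordP[w <-]; rewrite expsum_word // => w0.
have := rigid_word x x w; set w' := [seq _ | l <- w].
have c : all (fun l => l.1 == x) w' by apply/allP => _ /mapP[l _ ->] /=.
have s' : word_expsum w' = 0%R by rewrite -w0 /word_expsum big_map.
have [n [b [_ -> e]]] := reduce_constant_word hd c.
suff -> : n = 0%N by rewrite word_eval_nil invg1 mulg1.
move: s'; rewrite e /word_expsum big_nseq /= iter_addr_0.
by case: b {e} => /=; rewrite ?expr0 ?expr1; lia.
Qed.

End Branching.

(** * The first level *)

Section LevelOne.
Variable d : nat.
Hypotheses (hd : (3 <= d)%N) (hodd : odd d).
Implicit Types (g h s t : tree_aut d) (i j x y z : 'I_d) (v : 'rV[int]_d).

Definition realized v := exists2 f, liftable f & forall x, expsum (f x) = v 0 x.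

Lemma realized0 : realized 0.
Proof.
by exists (fun=> 1%g) => [|x]; [exact: liftable1 | rewrite expsum1 // mxE].
Qed.

Lemma realizedD v v' : realized v -> realized v' -> realized (v + v').
Proof.
move=> [f lf fv] [f' lf' fv']; exists (fun x => f x * f' x)%g.
  exact: liftableM.
by move=> x; rewrite mxE -fv -fv' expsumM //; apply: liftable_Gd.
Qed.

Lemma realizedN v : realized v -> realized (- v).
Proof.
move=> [f lf fv]; exists (fun x => (f x)^-1)%g; first exact: liftableV.
by move=> x; rewrite mxE -fv expsumV //; apply: liftable_Gd.
Qed.

Lemma realizedZ c v : realized v -> realized (c *: v).
Proof.
move=> rv; have nat_mul n : realized (n%:Z *: v).
  elim: n => [|n IHn]; first by rewrite scale0r; exact: realized0.
  by rewrite intS scalerDl scale1r; apply: realizedD.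
case: c => n; first exact: nat_mul.
by rewrite NegzE scaleNr; apply: realizedN.
Qed.

Lemma realized_sum (F : 'I_d -> 'rV[int]_d) :
  (forall x, realized (F x)) -> realized (\sum_x F x).
Proof.
by move=> rF; apply: big_ind => //; [exact: realized0 | exact: realizedD].
Qed.

Local Notation e := (delta_mx 0 : 'I_d -> 'rV[int]_d).

Lemma realized_square i : realized (2 *: (e i + e (ordS i))).
Proof.
have Si := ordS_neq hd i.
exists (fun x => if x == i then gen i * gen (ordS i) else
  if x == ordS i then gen (ordS i) * gen i else 1)%g => [|x].
  exists (gen i * gen i)%g; first by apply: GdM; exact: Gd_gen.
  move=> x; have [->|xi] := eqVneq x i.
    exact: maps_toM (gen_self i) (gen_succ hd i).
  have [->|xS] := eqVneq x (ordS i).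
    exact: maps_toM (gen_succ hd i) (gen_self i).
  apply: maps_to_eq (maps_toM (gen_other xi xS) (gen_other xi xS)) _.
  by rewrite mulg1.
rewrite !mxE /=; have [->|xi] := eqVneq x i.
  rewrite eq_sym (negPf Si) expsumM ?expsum_gen //; exact: Gd_gen.
have [_|xS] := eqVneq x (ordS i).
  rewrite expsumM ?expsum_gen //; exact: Gd_gen.
by rewrite expsum1.
Qed.

Lemma expsum_run n i : expsum (run n i) = n%:Z.
Proof.
elim: n i => [|n IHn] i; first by rewrite expsum1.
rewrite expsumM ?expsum_gen ?IHn -?intS //; [exact: Gd_gen | exact: Gd_run].
Qed.

Lemma run_fix n i x : (forall m, (m <= n)%N -> x != iter m (@ordS d) i) ->
  maps_to (run n i) x x 1%g.
Proof.
elim: n i => [|n IHn] i xi; first exact: maps_to1.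
apply: maps_to_eq (maps_toM (gen_other (xi 0%N isT) (xi 1%N isT)) (IHn _ _)) _.
  by move=> m mn; rewrite -iterSr; apply: xi.
by rewrite mulg1.
Qed.

(** A letter ahead of [i] waits until the run reaches it, is pushed one step
    back by the generator preceding it, and is left alone afterwards because
    the run has fewer than [d] factors. *)
Lemma run_back m n i : (m < n < d)%N ->
  maps_to (run n i) (iter m.+1 (@ordS d) i) (iter m (@ordS d) i)
    (gen (iter m.+1 (@ordS d) i)).
Proof.
elim: n m i => [|n IHn] [|m] i /andP[mn nd] //.
  apply: maps_to_eq (maps_toM (gen_succ hd i) (run_fix _)) _.
    by move=> k kn; rewrite -iterSr eq_sym iter_ordS_neq //; lia.
  by rewrite mulg1.
have x0 : iter m.+2 (@ordS d) i != i by rewrite iter_ordS_neq //; lia.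
have x1 : iter m.+2 (@ordS d) i != ordS i.
  by rewrite iterSr iter_ordS_neq //; lia.
apply: maps_to_eq (maps_toM (gen_other x0 x1) _) (mul1g _).
by rewrite iterSr [iter m.+1 _ i]iterSr; apply: IHn; lia.
Qed.

Lemma rotation_start i : maps_to (run d.-1 (ordS i)) (ordS i) i (run d.-1 (ordS i)).
Proof.
have := run_start d.-1 (ordS i); rewrite -iterSr prednK ?iter_ordS_period //; lia.
Qed.

(** Together with the preceding lemma: a run of length [d - 1] moves every
    letter one step back, whatever its starting index. *)
Lemma rotation_back i x : ordS x != i ->
  maps_to (run d.-1 i) (ordS x) x (gen (ordS x)).
Proof.
have [[|n] nd e] := ordS_iterP i (ordS x); first by rewrite e eqxx.
move=> _; rewrite e (ordS_inj e); apply: run_back; lia.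
Qed.

(** The quotient of the runs of length [d - 1] from [p = i] and from
    [q = i + 1]. A letter other than [p] and [q] has the same section for both
    runs; the long section of the first run sits at [p], that of the second one
    at [q]. *)
Lemma realized_rotation i : realized ((d%:Z - 2) *: (e i - e (ordS i))).
Proof.
have [y ->] := ordS_surj i; set p := ordS y; set q := ordS p.
have qp : q != p := ordS_neq hd p.
have Grun := @Gd_run d; have Ggen := @Gd_gen d.
exists (fun x => if x == p then run d.-1 p / gen p else
  if x == q then gen q / run d.-1 q else 1)%g => [|x].
  exists (run d.-1 p / run d.-1 q)%g; first by apply: GdM => //; exact: GdV.
  move=> x; have [->|xp] := eqVneq x p.
    apply: maps_toM (rotation_start y) (maps_toV (rotation_back _)).
    by rewrite eq_sym.
  have [->|xq] := eqVneq x q.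
    exact: maps_toM (rotation_back qp) (maps_toV (rotation_start p)).
  have [z xz] := ordS_surj x; rewrite xz in xp xq *.
  rewrite -(mulgV (gen (ordS z))).
  exact: maps_toM (rotation_back xp) (maps_toV (rotation_back xq)).
rewrite !mxE /=; have [->|xp] := eqVneq x p.
  rewrite eq_sym (negPf qp) expsumM ?expsumV ?expsum_gen ?expsum_run //; last exact: GdV.
  by lia.
have [_|xq] := eqVneq x q; last by rewrite expsum1 // subrr mulr0.
rewrite expsumM ?expsumV ?expsum_gen ?expsum_run //; last exact: GdV.
by lia.
Qed.

Lemma realized_diff2 i j : realized (2 *: (e i - e j)).
Proof.
move: i j; apply: odd_cyclic_connected => // [i|i j k ij jk|i].
- by rewrite subrr scaler0; exact: realized0.
- by have := realizedD ij jk; rewrite -scalerDr addrA subrK.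
have := realizedD (realized_square i) (realizedN (realized_square (ordS i))).
by rewrite -scalerBr opprD addrA addrK.
Qed.

Lemma realized_diff i j : realized (e i - e j).
Proof.
move: i j; apply: cyclic_connected => // [i|i j k ij jk|i].
- by rewrite subrr; exact: realized0.
- by have := realizedD ij jk; rewrite addrA subrK.
have := realizedD (realized_rotation i)
  (* [d - 2] is odd and [d - 2 - 2 (d./2 - 1) = 1]. *)
  (realizedZ (- (d./2%:Z - 1)) (realized_diff2 i (ordS i))).
rewrite scalerA -scalerDl.
have -> : d%:Z - 2 + - (d./2%:Z - 1) * 2 = 1.
  by have := odd_double_half d; rewrite hodd; lia.
by rewrite scale1r.
Qed.

Lemma realized_delta4 i : realized (4 *: e i).
Proof.
have := realizedD (realized_square i) (realized_diff2 i (ordS i)).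
by rewrite -scalerDr addrACA subrr addr0 -mulr2n -scaler_nat scalerA.
Qed.

(** Differences move all entries to one letter [o], which then carries a
    multiple of 4. *)
Lemma realizedP v : (4 %| \sum_x v 0%R x)%Z -> realized v.
Proof.
move=> /dvdzP[q vq]; have d0 : (0 < d)%N by lia.
pose o : 'I_d := Ordinal d0.
rewrite [v]row_sum_delta.
have -> : \sum_j v 0 j *: e j
    = \sum_j v 0 j *: (e j - e o) + q *: (4 *: e o).
  rewrite scalerA -vq scaler_suml -big_split /=; apply: eq_bigr => j _.
  by rewrite -scalerDr subrK.
apply: realizedD; last by apply: realizedZ; exact: realized_delta4.
by apply: realized_sum => x; apply: realizedZ; exact: realized_diff.
Qed.

Lemma liftable_rigid (f : 'I_d -> tree_aut d) :
  (forall x, rigid x (f x)) -> liftable f.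
Proof.
move=> rf.
suff H (r : seq 'I_d) : uniq r -> liftable (fun x => if x \in r then f x else 1%g).
  apply: eq_liftable (H _ (enum_uniq 'I_d)) => x.
  by rewrite mem_enum.
elim: r => [_|y r IHr /= /andP[yr /IHr lr]].
  by apply: eq_liftable (liftable1 d) => x.
apply: eq_liftable (liftableM (rf y) lr) => x.
rewrite inE; have [->|_] /= := eqVneq x y; last by rewrite mul1g.
by rewrite (negPf yr) mulg1.
Qed.

(** A family with the right exponent sums differs from [f] by elements of
    exponent sum 0, which can be inserted letter by letter. *)
Theorem liftable_of_expsum (f : 'I_d -> tree_aut d) : (forall x, Gd (f x)) ->
  (4 %| \sum_x expsum (f x))%Z -> liftable f.
Proof.
move=> Gf f4.
have [|f' lf' ff'] := @realizedP (\row_x expsum (f x)).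
  by under eq_bigr do rewrite mxE.
have Gf' x := liftable_Gd x lf'.
have lq : liftable (fun x => f x / f' x)%g.
  apply: liftable_rigid => x; apply: rigid_expsum0 => //.
    by apply: GdM => //; exact: GdV.
  by rewrite expsumM ?expsumV // ?ff' ?mxE ?subrr //; exact: GdV.
by apply: eq_liftable (liftableM lq lf') => x; rewrite mulgVK.
Qed.

Lemma sum_expsum_section g : Gd g ->
  \sum_x expsum (section g [:: x]) = expsum g *+ 2.
Proof.
move=> /Gd_wordP[w <-]; rewrite expsum_word // -sum_word_sec //.
apply: eq_bigr => x _; rewrite -expsum_word //; congr expsum.
have [y m] := maps_to_section (word_eval w) x.
by have [] := maps_to_unique m (word_evalE w x).
Qed.

Lemma expsum_even g : Gd g -> (forall x, g [:: x] = [:: x]) ->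
  (2 %| expsum g)%Z.
Proof.
move=> /Gd_wordP[w <-] w1; rewrite expsum_word //.
have p1 : word_perm w = 1%g.
  by apply/permP => x; rewrite perm1; have := w1 x; rewrite word_evalE => -[].
have := word_perm_odd hd w; rewrite p1 odd_perm1; lia.
Qed.
End LevelOne.

(** * All levels *)

Section AllLevels.
Variable d : nat.
Implicit Types (g h s t : tree_aut d) (x : 'I_d) (u v : seq 'I_d).

Lemma section_nil g : section g [::] = g.
Proof. by apply: tree_autP => v; rewrite -[in RHS](cat0s v) sectionE aut_root. Qed.

Lemma section_cons g x v : section g (x :: v) = section (section g [:: x]) v.
Proof.
apply: tree_autP => w; have := sectionE g (x :: v) w; rewrite -cat1s -catA.
rewrite !sectionE -catA => /eqP; rewrite eqseq_cat // eqxx /=.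
by rewrite eqseq_cat // eqxx => /eqP.
Qed.

Lemma big_levelS (R : nmodType) k (F : seq 'I_d -> R) :
  \sum_(u <- level d k.+1) F u = \sum_x \sum_(v <- level d k) F (x :: v).
Proof. by rewrite /= big_allpairs_dep big_enum. Qed.

Hypotheses (hd : (3 <= d)%N) (hodd : odd d).

Lemma sum_expsum_level k g : Gd g ->
  \sum_(v <- level d k) expsum (section g v) = 2 ^+ k * expsum g.
Proof.
elim: k g => [|k IHk] g Gg.
  by rewrite /= big_seq1 section_nil mul1r.
rewrite big_levelS exprSr -mulrA [2 * _]mulr_natl -sum_expsum_section //.
rewrite mulr_sumr; apply: eq_bigr => x _.
by under eq_bigr do rewrite section_cons; rewrite IHk //; exact: Gd_section.
Qed.

Lemma St_letters k g : St k.+1 g <->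
  Gd g /\ forall x, maps_to g x x (section g [:: x]) /\ St k (section g [:: x]).
Proof.
split=> [[Gg fix_g]|[Gg fix_g]]; split=> //.
  have cons_g x v : size v = k -> g [:: x] = [:: x] /\ section g [:: x] v = v.
    move=> vk; have := fix_g (x :: v); rewrite /= vk => /(_ erefl).
    rewrite -cat1s sectionE => /eqP; rewrite eqseq_cat ?size_aut //.
    by move=> /andP[/eqP gx /eqP gv].
  move=> x; split; last first.
    by split=> [|v vk]; [exact: Gd_section | case: (cons_g x v vk)].
  have [y m] := maps_to_section g x.
  have [gx _] := cons_g x (nseq k x) (size_nseq _ _).
  by have := m [::]; rewrite gx => -[yx _]; rewrite -yx in m.
case=> // x v [vk]; have [m [_ fv]] := fix_g x.
by rewrite m fv.
Qed.

(** The conditions at nonempty [u] are those of the families below the first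
    letter of [u]. The only other condition, at the root and for [r] equal to
    the whole depth, is the condition modulo 4 on the first level, multiplied by
    a power of 2. *)
Theorem realizable_sections k (h : seq 'I_d -> tree_aut d) :
  (forall u, size u = k -> Gd (h u)) ->
  (exists2 s, St k s & forall u, size u = k -> section s u = h u) <->
  (forall r u, (1 <= r <= k)%N -> size u = (k - r)%N ->
     (2 ^+ r.+1 %| \sum_(v <- level d r) expsum (h (u ++ v)))%Z).
Proof.
elim: k h => [|k IHk] h Gh.
  split=> [_ [] //|_]; exists (h [::]) => [|u].
    by split=> [|u]; [exact: Gh | move/size0nil=> ->; rewrite aut_root].
  by move/size0nil=> ->; rewrite section_nil.
have Gx x u : size u = k -> Gd (h (x :: u)) by move=> uk; apply: Gh; rewrite /= uk.
split=> [[s /St_letters[Gs sx] sh]|div_h].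
  move=> r [|x u] /andP[r1 rk].
    move/eqP; rewrite eq_sym subn_eq0 => kr.
    have {kr rk r1} -> : r = k.+1 by lia.
    rewrite [X in (_ %| X)%Z](_ :
      _ = \sum_(v <- level d k.+1) expsum (section s v)); last first.
      rewrite !big_seq; apply: eq_bigr => v; rewrite mem_level => /eqP vk.
      by rewrite sh.
    rewrite sum_expsum_level // [2 ^+ k.+2]exprSr dvdz_mul2l //.
      apply: expsum_even => // x; have [m _] := sx x.
      by rewrite -[[:: x]]/(x :: [::]) m aut_root.
    by rewrite expf_neq0.
  move=> /= /eqP uk; have {uk} [rk' uk] : (r <= k)%N /\ size u = (k - r)%N by lia.
  have [/(_ _)] := IHk (fun v => h (x :: v)) (Gx x).
  move=> H _; apply: H => //; last by rewrite r1.
  exists (section s [:: x]) => [|v vk]; first by case: (sx x).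
  by rewrite -section_cons sh //= vk.
have /choice[g gP] x : exists g,
    St k g /\ forall u, size u = k -> section g u = h (x :: u).
  have [_ [r u rk uk|g Sg gh]] := IHk (fun v => h (x :: v)) (Gx x); last by exists g.
  by apply: (div_h r (x :: u)) => /=; lia.
have Gg x : Gd (g x) by case: (gP x) => -[].
have [|s Gs sx] := liftable_of_expsum hd hodd Gg.
  have sum_x x : \sum_(v <- level d k) expsum (h (x :: v)) = 2 ^+ k * expsum (g x).
    rewrite -sum_expsum_level // !big_seq; apply: eq_bigr => v.
    by rewrite mem_level => /eqP vk; rewrite (proj2 (gP x) v vk).
  have := div_h k.+1 [::]; rewrite leqnn subnn big_levelS => /(_ isT erefl).
  under eq_bigr do rewrite sum_x.
  by rewrite -mulr_sumr !exprSr -mulrA dvdz_mul2l // expf_neq0.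
have secx x : section s [:: x] = g x.
  by have [y m] := maps_to_section s x; have [] := maps_to_unique m (sx x).
exists s => [|[|x u] //= [uk]].
  apply/St_letters; split=> // x; rewrite secx; split=> //.
  by case: (gP x).
by rewrite section_cons secx (proj2 (gP x)).
Qed.

Lemma level_cat m r : level d (m + r) = [seq u ++ v | u <- level d m, v <- level d r].
Proof.
elim: m => [|m IHm] /=; first by rewrite cats0 map_id.
rewrite IHm; elim: (enum 'I_d) => //= x e IHe.
rewrite IHe allpairs_cat; congr (_ ++ _).
by rewrite allpairs_mapl map_allpairs.
Qed.

Lemma uniq_level k : uniq (level d k).
Proof.
by apply: sorted_uniq (sorted_level d k) => [y x z|x]; [exact: lt_trans | rewrite ltxx].
Qed.

End AllLevels.

Lemma nth_allpairs_mul (S T U : Type) (f : S -> T -> U) (s : seq S) (t : seq T)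
    x0 y0 z0 n i : (n < size s)%N -> (i < size t)%N ->
  nth z0 [seq f x y | x <- s, y <- t] (size t * n + i) =
  f (nth x0 s n) (nth y0 t i).
Proof.
elim: s n => //= x s IHs [|n] ns it; rewrite nth_cat size_map.
  by rewrite muln0 add0n it (nth_map y0).
by rewrite mulnS -addnA ltnNge leq_addr /= addKn IHs.
Qed.

Theorem theorem4p9 (d k : nat) (hd : (3 <= d)%N) (hodd : odd d) (hk : (1 <= k)%N)
    (h : (d ^ k).-tuple (tree_aut d)) (hG : forall i, Gd (tnth h i)) :
  (psi k @` @St d k) h <->
  (forall r t : nat, (1 <= r <= k)%N -> (t < d ^ (k - r))%N ->
     (\sum_(i < (d ^ r)%N) expsum (nth 1%g h (d ^ r * t + i)%N)
        = 0 %[mod 2 ^+ r.+1])%Z).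
Proof.
pose f u := nth 1%g h (index u (level d k)).
have sz m : size (level d m) = (d ^ m)%N by exact/eqP/size_level.
have f_nth i : (i < d ^ k)%N -> f (nth [::] (level d k) i) = nth 1%g h i.
  by move=> ik; rewrite /f index_uniq ?sz // uniq_level.
have Gf u : size u = k -> Gd (f u).
  move=> uk; rewrite /f; have : (index u (level d k) < d ^ k)%N.
    by rewrite -sz index_mem mem_level uk.
  by move=> ik; have := hG (Ordinal ik); rewrite (tnth_nth 1%g).
have -> : (psi k @` @St d k) h <->
    exists2 s, St k s & forall u, size u = k -> section s u = f u.
  split=> -[s Ss sf]; exists s => //.
    move=> u uk; rewrite /f -sf /= (nth_map [::]) ?nth_index ?index_mem ?mem_level ?uk //.
  apply/val_inj/(@eq_from_nth _ 1%g) => [|i]; rewrite /= size_map sz ?size_tuple // => ik.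
  rewrite (nth_map [::]) ?sz // sf ?f_nth //.
  by apply/eqP; rewrite -mem_level mem_nth ?sz.
rewrite (realizable_sections hd hodd Gf).
(* The entries of [h] from [d ^ r * t] on belong to the words that begin with
   the [t]-th word of length [k - r]. *)
have block r t : (1 <= r <= k)%N -> (t < d ^ (k - r))%N ->
    \sum_(v <- level d r) expsum (f (nth [::] (level d (k - r)) t ++ v)) =
    \sum_(i < (d ^ r)%N) expsum (nth 1%g h (d ^ r * t + i)%N).
  move=> /andP[_ rk] tk; rewrite (big_nth [::]) sz big_mkord.
  apply: eq_bigr => i _; congr expsum.
  rewrite -f_nth; last first.
    rewrite -(subnK rk) expnD mulnC; have := ltn_ord i; nia.
  congr f; rewrite -[in RHS](subnK rk) level_cat.
  have := @nth_allpairs_mul _ _ _ cat (level d (k - r)) (level d r) [::] [::] [::].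
  by rewrite !sz => ->.
split=> H r t rk tk.
  rewrite -block //; apply/eqP; rewrite eqz_mod_dvd subr0; apply: H => //.
  by apply/eqP; rewrite -mem_level mem_nth ?sz.
have tl : t \in level d (k - r) by rewrite mem_level; apply/eqP.
have ik : (index t (level d (k - r)) < d ^ (k - r))%N by rewrite -sz index_mem.
have := H r _ rk ik; rewrite -block // nth_index // => /eqP.
by rewrite eqz_mod_dvd subr0.
Qed.
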